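(* Let $N$ and $h$ be positive integers with $1 \leq h \leq 2N^2$, and let $\varepsilon>0$. Then \[ T(h,N) = \frac{16}{\zeta(2)} N^2 \Big( \sum_{d \mid h} \frac{1}{d} \Big) + O_{\varepsilon}\big(N^{\varepsilon} (h + N)\big), \] where the implied constant depends only on $\varepsilon$.
   Context: For positive integers $h,N$, $T(h,N)$ denotes the number of $(a,b,c,d)\in\mathbb{Z}^4$ with $ad-bc=h$ and $|a|,|b|,|c|,|d|\leq N$ (i.e. the number of $2\times 2$ integer matrices with determinant $h$ and entries in $[-N,N]$). $\zeta$ is the Riemann zeta function. The notation $Y=O_\varepsilon(X)$ means $|Y|\leq C_\varepsilon X$ for a constant $C_\varepsilon>0$ depending only on $\varepsilon$. *)

(* Defs.v *)
From HB Require Import structures.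
From mathcomp Require Import all_boot all_order all_algebra finmap.
From mathcomp Require Import all_classical all_reals all_analysis.
From mathcomp Require Import zify ring lra.

Set Implicit Arguments.
Unset Strict Implicit.
Unset Printing Implicit Defensive.

Import Order.TTheory GRing.Theory Num.Theory.
Import numFieldNormedType.Exports.

Local Open Scope classical_set_scope.
Local Open Scope ring_scope.

Definition det_box (h N : nat) : set (int * int * int * int) :=
  [set x | let: (a, b, c, d) := x in
     [/\ a * d - b * c = h%:Z,
         `|a| <= N%:Z, `|b| <= N%:Z, `|c| <= N%:Z & `|d| <= N%:Z]].

Definition T (h N : nat) : nat := #|` fset_set (det_box h N) |.

(* Dirichlet series of the Riemann zeta function; meaningful for real s > 1,
   where riemannR s n = (n + 1)^(-s). *)
Definition zeta (R : realType) (s : R) : R := limn (series (riemannR s)).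

(* fset_set and lim return junk values on infinite sets and divergent
   sequences; the next two facts rule this out for T and zeta 2. *)
Lemma finite_det_box (h N : nat) : finite_set (det_box h N).
Proof.
pose I : set int := [set` [seq i%:Z - N%:Z | i <- iota 0 N.*2.+1]].
have II (a : int) : `|a| <= N%:Z -> I a.
  move=> aN; apply/mapP; exists (absz (a + N%:Z)); last by lia.
  by rewrite mem_iota; lia.
apply: (@sub_finite_set _ _ (((I `*` I) `*` I) `*` I)).
  by move=> [[[a b] c] d] [_ aN bN cN dN]; split; [split; [split|]|]; exact: II.
by do ?apply: finite_setX; exact: finite_seq.
Qed.

Lemma is_cvg_zeta2 (R : realType) : cvgn (series (riemannR (2 : R))).
Proof.
apply: nondecreasing_is_cvgn.
  by apply: nondecreasing_series => n _ _; apply/ltW/riemannR_gt0.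
exists 2 => _ [n _ <-].
suff H : forall m, series (riemannR (2 : R)) m.+1 <= 2 - m.+1%:R^-1.
  case: n => [|n]; first by rewrite /series /= big_geq.
  by apply: (le_trans (H n)); rewrite gerBl invr_ge0.
elim=> [|m IH].
  by rewrite /series /= big_nat1 /riemannR powR1 invr1; lra.
rewrite /series /= big_nat_recr//= -[X in X + _]/(series (riemannR 2) m.+1).
apply: (le_trans (lerD IH (lexx _))).
rewrite /riemannR powR_mulrn// -subr_ge0.
have m1 : (0 : R) < m.+1%:R by rewrite ltr0n.
have -> : m.+2%:R = m.+1%:R + 1 :> R by rewrite -natr1.
set x := m.+1%:R in m1 *.
have -> : 2 - (x + 1)^-1 - (2 - x^-1 + ((x + 1) ^+ 2)^-1)
   = (x * (x + 1) ^+ 2)^-1 :> R.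
  by field; apply/andP; split; rewrite gt_eqF//; lra.
by rewrite invr_ge0 mulr_ge0 ?sqr_ge0// ltW.
Qed.

(* Main.v *)
Require Import Defs.
From HB Require Import structures.
From mathcomp Require Import all_boot all_order all_algebra finmap.
From mathcomp Require Import all_classical all_reals all_analysis.
From mathcomp Require Import zify ring lra.

(** Up to ties, a solution has a unique entry of largest modulus; column swaps,
    row swaps and the map (a, d) |-> (- a, - d) move it to a positive a, so
    T(h, N) is close to 8 times the number of solutions with a > 0 maximal. For
    these, d is determined by a, b, c with b c = - h mod a, and |d| <= a is
    automatic unless a < |d| <= a + h / a. In that range, as for ties, one entry
    divides h or the product of two entries is a prescribed nonzero number, so
    the divisor bound leaves O(N^eps (h + N)) exceptions. When b, c run over two
    full periods modulo a, the congruence has exactly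
    4 \sum_(1 <= y <= a) F(gcd(a, y)) solutions, where F(g) is g if g | h and 0
    otherwise. Summing over a <= N reduces the theorem to the number of pairs in
    [1, N]^2 with gcd g, which Moebius inversion evaluates as
    N^2 / (zeta(2) g^2) + O(N^(1 + eps) / g). *)

Import Order.TTheory GRing.Theory Num.Theory.
Import numFieldNormedType.Exports.

Set Implicit Arguments.
Unset Strict Implicit.
Unset Printing Implicit Defensive.

Local Open Scope ring_scope.

(** * Solutions with a largest entry *)

Section CountingTools.
Local Open Scope nat_scope.

Lemma count_le_inj (T : eqType) (s : seq T) (P Q : pred T) (f : T -> T) :
    uniq s -> injective f ->
    {in s, forall x, P x -> (f x \in s) && Q (f x)} ->
  count P s <= count Q s.
Proof.
move=> us fI fPQ; rewrite -!size_filter -(size_map f) uniq_leq_size//.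
  by rewrite (map_inj_uniq fI) filter_uniq.
move=> y /mapP[x]; rewrite mem_filter => /andP[Px xs] ->.
by rewrite mem_filter andbC fPQ.
Qed.

Lemma count_le_cover (T : eqType) (s t : seq T) (P : pred T) :
  uniq s -> {in s, forall x, P x -> x \in t} -> count P s <= size t.
Proof.
move=> us Pt; rewrite -size_filter uniq_leq_size ?filter_uniq//.
by move=> x; rewrite mem_filter => /andP[Px xs]; exact: Pt.
Qed.

Lemma count_or_le (T : Type) (s : seq T) (P Q : pred T) :
  count (fun x => P x || Q x) s <= count P s + count Q s.
Proof. by rewrite -count_predUI leq_addr. Qed.

Lemma size_allpairs_dep_le (S T U : eqType) (f : S -> T -> U) (s : seq S)
    (t : S -> seq T) (m : nat) :
    {in s, forall x, size (t x) <= m} ->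
  size [seq f x y | x <- s, y <- t x] <= size s * m.
Proof.
move=> tm; rewrite size_allpairs_dep sumnE big_map.
apply: (@leq_trans (\sum_(x <- s) m)).
  by rewrite !big_seq; apply: leq_sum => x; exact: tm.
by rewrite big_const_seq count_predT iter_addn_0 mulnC.
Qed.

End CountingTools.

Definition int_range (N : nat) : seq int :=
  [seq i%:Z - N%:Z | i <- iota 0 N.*2.+1].

Lemma mem_int_range (N : nat) (a : int) : (a \in int_range N) = (`|a| <= N%:Z).
Proof.
apply/mapP/idP => [[i]|aN]; first by rewrite mem_iota => iN ->; lia.
by exists (absz (a + N%:Z)); [rewrite mem_iota; lia|lia].
Qed.

Lemma size_int_range (N : nat) : size (int_range N) = N.*2.+1.
Proof. by rewrite size_map size_iota. Qed.

Definition int_divisors (n : nat) : seq int :=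
  [seq s * d%:Z | s <- [:: 1; -1], d <- divisors n].

Lemma mem_int_divisors (n : nat) (a : int) :
  (0 < n)%N -> (`|a| %| n)%N -> a \in int_divisors n.
Proof.
move=> n0 an; apply/allpairsP; exists (if 0 <= a then 1 else -1, `|a|%N) => /=.
rewrite -dvdn_divisors//; case: ifP => a0; rewrite !inE/=; split => //; lia.
Qed.

Lemma size_int_divisors (n : nat) :
  size (int_divisors n) = (2 * size (divisors n))%N.
Proof. by rewrite size_allpairs. Qed.

(** * Symmetries of the solution set, maximal entries and ties *)

Definition quad : Type := int * int * int * int.

(** A duplicate-free enumeration of the solutions, along which [count] measures every class below;
    [fset_set (det_box h N)] is one such list. *)
Definition is_det_seq (h N : nat) (s : seq quad) : Prop :=
  uniq s /\ forall a b c d : int, ((a, b, c, d) \in s) =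
    [&& a * d - b * c == h%:Z, `|a| <= N%:Z, `|b| <= N%:Z, `|c| <= N%:Z
      & `|d| <= N%:Z].

(** In this map and the next three, the signs are chosen so that the determinant is preserved; the
    moduli of the entries are only permuted. *)
Definition swap_cols (x : quad) : quad :=
  let: (a, b, c, d) := x in (b, - a, d, - c).
Definition swap_rows (x : quad) : quad :=
  let: (a, b, c, d) := x in (c, d, - a, - b).
Definition transpose (x : quad) : quad :=
  let: (a, b, c, d) := x in (a, c, b, d).
Definition neg_diag (x : quad) : quad :=
  let: (a, b, c, d) := x in (- a, b, c, - d).

Lemma swap_cols_inj : injective swap_cols.
Proof.
move=> [[[a b] c] d] [[[a' b'] c'] d'] [] -> /oppr_inj -> -> /oppr_inj ->.
by [].
Qed.

Lemma swap_rows_inj : injective swap_rows.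
Proof.
move=> [[[a b] c] d] [[[a' b'] c'] d'] [] -> -> /oppr_inj -> /oppr_inj ->.
by [].
Qed.

Lemma transpose_inj : injective transpose.
Proof. by move=> [[[a b] c] d] [[[a' b'] c'] d'] [] -> -> -> ->. Qed.

Lemma neg_diag_inj : injective neg_diag.
Proof.
move=> [[[a b] c] d] [[[a' b'] c'] d'] [] /oppr_inj -> -> -> /oppr_inj ->.
by [].
Qed.

Lemma is_det_seq_sym (h N : nat) (s : seq quad) : is_det_seq h N s ->
  forall x, x \in s ->
    [/\ swap_cols x \in s, swap_rows x \in s, transpose x \in s
      & neg_diag x \in s].
Proof.
move=> [_ ms] [[[a b] c] d]; rewrite /= !ms => /and5P[/eqP H ? ? ? ?].
by split; apply/and5P; split; rewrite ?normrN//; apply/eqP; rewrite -H; ring.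
Qed.

Definition max_a (x : quad) : bool :=
  let: (a, b, c, d) := x in [&& `|b| <= `|a|, `|c| <= `|a| & `|d| <= `|a|].
Definition max_b (x : quad) : bool :=
  let: (a, b, c, d) := x in [&& `|a| <= `|b|, `|c| <= `|b| & `|d| <= `|b|].
Definition max_c (x : quad) : bool :=
  let: (a, b, c, d) := x in [&& `|a| <= `|c|, `|b| <= `|c| & `|d| <= `|c|].
Definition max_d (x : quad) : bool :=
  let: (a, b, c, d) := x in [&& `|a| <= `|d|, `|b| <= `|d| & `|c| <= `|d|].
Definition max_pos_a (x : quad) : bool :=
  let: (a, b, c, d) := x in (0 < a) && max_a x.

Definition tie_ab (x : quad) : bool := let: (a, b, c, d) := x in `|a| == `|b|.
Definition tie_ac (x : quad) : bool := let: (a, b, c, d) := x in `|a| == `|c|.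
Definition tie_ad (x : quad) : bool := let: (a, b, c, d) := x in `|a| == `|d|.
Definition tie_bc (x : quad) : bool := let: (a, b, c, d) := x in `|b| == `|c|.
Definition tie_bd (x : quad) : bool := let: (a, b, c, d) := x in `|b| == `|d|.
Definition tie_cd (x : quad) : bool := let: (a, b, c, d) := x in `|c| == `|d|.

Lemma size_le_max_counts (s : seq quad) :
  (size s <= count max_a s + count max_b s + count max_c s + count max_d s)%N.
Proof.
elim: s => //= -[[[a b] c] d] s IH.
suff : [|| max_a (a, b, c, d), max_b (a, b, c, d), max_c (a, b, c, d)
          | max_d (a, b, c, d)].
  by case: max_a; case: max_b; case: max_c; case: max_d; lia.
rewrite /=; move: `|a| `|b| `|c| `|d| => w x y z {IH s a b c d}.
have [wx|/ltW xw] := leP w x; have [yz|/ltW zy] := leP y z.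
- have [xz|/ltW zx] := leP x z.
    by rewrite ?yz ?xz (le_trans wx xz) ?orbT.
  by rewrite ?wx ?zx (le_trans yz zx) ?orbT.
- have [xy|/ltW yx] := leP x y.
    by rewrite ?zy ?xy (le_trans wx xy) ?orbT.
  by rewrite ?wx ?yx (le_trans zy yx) ?orbT.
- have [wz|/ltW zw] := leP w z.
    by rewrite ?yz ?wz (le_trans xw wz) ?orbT.
  by rewrite ?xw ?zw (le_trans yz zw) ?orbT.
- have [wy|/ltW yw] := leP w y.
    by rewrite ?zy ?wy (le_trans xw wy) ?orbT.
  by rewrite ?xw ?yw (le_trans zy yw) ?orbT.
Qed.

(** Two maximal entries of one solution have equal modulus. A solution counted more than once thus
    has a tie, and its excess is at most 3. *)
Lemma max_counts_le_size (s : seq quad) :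
  (count max_a s + count max_b s + count max_c s + count max_d s <=
   size s + 3 * (count tie_ab s + count tie_ac s + count tie_ad s
                 + count tie_bc s + count tie_bd s + count tie_cd s))%N.
Proof.
elim: s => //= -[[[a b] c] d] s IH.
suff : (max_a (a, b, c, d) + max_b (a, b, c, d) + max_c (a, b, c, d)
   + max_d (a, b, c, d) <= 1 + 3 * (tie_ab (a, b, c, d) + tie_ac (a, b, c, d)
   + tie_ad (a, b, c, d) + tie_bc (a, b, c, d) + tie_bd (a, b, c, d)
   + tie_cd (a, b, c, d)))%N by lia.
have ab : max_a (a, b, c, d) && max_b (a, b, c, d) -> tie_ab (a, b, c, d).
  by rewrite /= eq_le => /andP[/and3P[-> _ _] /and3P[-> _ _]].
have ac : max_a (a, b, c, d) && max_c (a, b, c, d) -> tie_ac (a, b, c, d).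
  by rewrite /= eq_le => /andP[/and3P[_ -> _] /and3P[-> _ _]].
have ad : max_a (a, b, c, d) && max_d (a, b, c, d) -> tie_ad (a, b, c, d).
  by rewrite /= eq_le => /andP[/and3P[_ _ ->] /and3P[-> _ _]].
have bc : max_b (a, b, c, d) && max_c (a, b, c, d) -> tie_bc (a, b, c, d).
  by rewrite /= eq_le => /andP[/and3P[_ -> _] /and3P[_ -> _]].
have bd : max_b (a, b, c, d) && max_d (a, b, c, d) -> tie_bd (a, b, c, d).
  by rewrite /= eq_le => /andP[/and3P[_ _ ->] /and3P[_ -> _]].
have cd : max_c (a, b, c, d) && max_d (a, b, c, d) -> tie_cd (a, b, c, d).
  by rewrite /= eq_le => /andP[/and3P[_ _ ->] /and3P[_ _ ->]].
move: ab ac ad bc bd cd {IH}.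
move: (max_a _) (max_b _) (max_c _) (max_d _) (tie_ab _) (tie_ac _) (tie_ad _)
  (tie_bc _) (tie_bd _) (tie_cd _) => p q r t; clear => ab ac ad bc bd cd.
have le1 (x y z : bool) : (x && y -> z) -> (x + y <= 1 + z)%N.
  by case: x; case: y; case: z => // /(_ isT).
move=> /le1 h1 /le1 h2 /le1 h3 /le1 h4 /le1 h5 /le1 h6.
move: (leq_b1 p) (leq_b1 q) (leq_b1 r) (leq_b1 t).
move: (p : nat) (q : nat) (r : nat) (t : nat) (ab : nat) (ac : nat) (ad : nat)
  (bc : nat) (bd : nat) (cd : nat) h1 h2 h3 h4 h5 h6; clear; lia.
Qed.

Section Symmetry.
Variables (h N : nat) (s : seq quad).
Hypothesis sP : is_det_seq h N s.

Let us : uniq s. Proof. by case: sP. Qed.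

Lemma count_max_b : count max_b s = count max_a s.
Proof.
apply/eqP; rewrite eqn_leq; apply/andP; split;
  apply: (count_le_inj us swap_cols_inj) => x xs;
  have [-> _ _ _] := is_det_seq_sym sP xs;
  move: x {xs} => [[[a b] c] d] /=; rewrite !normrN => /and3P[-> -> ->] //.
Qed.

Lemma count_max_c : count max_c s = count max_a s.
Proof.
apply/eqP; rewrite eqn_leq; apply/andP; split;
  apply: (count_le_inj us swap_rows_inj) => x xs;
  have [_ -> _ _] := is_det_seq_sym sP xs;
  move: x {xs} => [[[a b] c] d] /=; rewrite !normrN => /and3P[-> -> ->] //.
Qed.

Lemma count_max_d : count max_d s = count max_a s.
Proof.
rewrite -count_max_c; apply/eqP; rewrite eqn_leq; apply/andP; split;
  apply: (count_le_inj us swap_cols_inj) => x xs;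
  have [-> _ _ _] := is_det_seq_sym sP xs;
  move: x {xs} => [[[a b] c] d] /=; rewrite !normrN => /and3P[-> -> ->] //.
Qed.

(** Under the symmetries the six ties form two classes: pairs sharing a row or a column, controlled
    by [tie_ab], and the two diagonals, controlled by [tie_ad]. *)
Lemma count_tie_ac : (count tie_ac s <= count tie_ab s)%N.
Proof.
apply: (count_le_inj us transpose_inj) => x xs.
by have [_ _ -> _] := is_det_seq_sym sP xs; move: x {xs} => [[[a b] c] d].
Qed.

Lemma count_tie_cd : (count tie_cd s <= count tie_ab s)%N.
Proof.
apply: (count_le_inj us swap_rows_inj) => x xs.
by have [_ -> _ _] := is_det_seq_sym sP xs; move: x {xs} => [[[a b] c] d].
Qed.

Lemma count_tie_bd : (count tie_bd s <= count tie_ab s)%N.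
Proof.
apply: (leq_trans _ count_tie_ac).
apply: (count_le_inj us swap_cols_inj) => x xs.
by have [-> _ _ _] := is_det_seq_sym sP xs; move: x {xs} => [[[a b] c] d].
Qed.

Lemma count_tie_bc : (count tie_bc s <= count tie_ad s)%N.
Proof.
apply: (count_le_inj us swap_cols_inj) => x xs.
have [-> _ _ _] := is_det_seq_sym sP xs; move: x {xs} => [[[a b] c] d] /=.
by rewrite normrN.
Qed.

(** [neg_diag] exchanges the signs of a. The value a = 0 cannot be maximal, since all entries would
    then vanish while h > 0. *)
Lemma count_max_pos_a : (0 < h)%N -> count max_a s = (2 * count max_pos_a s)%N.
Proof.
move=> h0; pose max_neg_a (x : quad) := ~~ max_pos_a x && max_a x.
have -> : count max_a s = (count max_pos_a s + count max_neg_a s)%N.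
  elim: (s) => //= x r ->; rewrite /max_neg_a.
  have : max_pos_a x -> max_a x by move: x => [[[a b] c] d] /andP[].
  by case: max_pos_a => [->//|_ /=]; lia.
have -> : count max_neg_a s = count max_pos_a s; last by lia.
apply/eqP; rewrite eqn_leq; apply/andP; split;
  apply: (count_le_inj us neg_diag_inj) => x xs;
  have [_ _ _ ->] := is_det_seq_sym sP xs; move: xs;
  case: sP => _ ms; move: x => [[[a b] c] d]; rewrite ms /max_neg_a /= !normrN.
  move=> /andP[/eqP H _] /andP[/negP aN /[dup] /and3P[? ? ?] ->].
  rewrite andbT oppr_gt0 ltNge; apply/negP => a0; apply: aN.
  rewrite andbC; apply/andP; split; first by apply/and3P.
  rewrite lt_neqAle a0 andbT; apply/negP => /eqP a00; subst a.
  have [? ? ?] : [/\ b = 0, c = 0 & d = 0] by split; lia.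
  by subst; move: H; rewrite mul0r subr0; lia.
move=> _ /andP[a0 ->]; rewrite andbT oppr_gt0.
by apply/negP => /andP[]; lia.
Qed.
End Symmetry.

(** * Ties bounded by numbers of divisors *)

Definition divisors_bound (n t : nat) : Prop :=
  forall k, (k <= n)%N -> (size (divisors k) <= t)%N.

Lemma size_int_divisors_le (n t k : nat) : divisors_bound n t ->
  (k <= n)%N -> (size (int_divisors k) <= 2 * t)%N.
Proof. by move=> tP kn; rewrite size_int_divisors leq_mul2l tP. Qed.

Lemma dvdz_eq_divz (a d n : int) : a != 0 -> a * d = n -> d = (n %/ a)%Z.
Proof. by move=> a0 <-; rewrite mulrC mulzK. Qed.

(** If b = e a with e = 1 or -1, then a (d - e c) = h. So a is a signed divisor of h, and a, e, c
    determine d. *)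
Lemma count_tie_ab_le (h N t : nat) (s : seq quad) :
    is_det_seq h N s -> (0 < h)%N -> divisors_bound h t ->
  (count tie_ab s <= 4 * t * N.*2.+1)%N.
Proof.
move=> [us ms] h0 tP.
pose l : seq quad := [seq (p.1, p.2 * p.1, c, ((h%:Z + p.2 * p.1 * c) %/ p.1)%Z)
  | p <- [seq (a, e) | a <- int_divisors h, e <- [:: 1; -1]],
    c <- int_range N].
have -> : (4 * t = 2 * t * 2)%N by lia.
apply: (@leq_trans (size l)); last first.
  rewrite size_allpairs size_int_range leq_mul2r size_allpairs leq_mul2r.
  by rewrite (size_int_divisors_le tP) ?orbT.
apply: count_le_cover => // -[[[a b] c] d]; rewrite ms.
move=> /and5P[/eqP H aN bN cN dN] /= ab.
have [e ee be] : exists2 e, e \in [:: 1; -1] & b = e * a.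
  have [->|->] : b = a \/ b = - a by lia.
    by exists 1; rewrite ?inE ?mul1r.
  by exists (-1); rewrite ?inE ?mulN1r.
subst b; have adh : a * (d - e * c) = h by rewrite -H; ring.
have a0 : a != 0 by apply/negP => /eqP a0; move: adh; rewrite a0 mul0r; lia.
have ah : (`|a| %| h)%N.
  by rewrite -[h]/(absz h%:Z) -adh abszM dvdn_mulr.
apply/allpairsP; exists ((a, e), c); split; last 1 first.
- by congr (_, _); apply: dvdz_eq_divz => //=; rewrite -H; ring.
- apply/allpairsP; exists (a, e); split => //=.
  exact: mem_int_divisors.
- by rewrite mem_int_range.
Qed.

(* The boolean component selects which of b and c vanishes. *)
Definition zero_prod_cover (h N : nat) : seq quad :=
  [seq (p.1, if p.2 then 0 else e, if p.2 then e else 0, (h%:Z %/ p.1)%Z)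
  | p <- [seq (a, z) | a <- int_divisors h, z <- [:: true; false]],
    e <- int_range N].

Lemma size_zero_prod_cover (h N t : nat) : divisors_bound h t ->
  (size (zero_prod_cover h N) <= 4 * t * N.*2.+1)%N.
Proof.
move=> tP.
have -> : (4 * t = 2 * t * 2)%N by lia.
rewrite size_allpairs size_int_range leq_mul2r size_allpairs leq_mul2r.
by rewrite (size_int_divisors_le tP) ?orbT.
Qed.

Lemma mem_zero_prod_cover (h N : nat) (a b c d : int) :
    (0 < h)%N -> a * d = h%:Z -> b * c = 0 -> `|b| <= N%:Z -> `|c| <= N%:Z ->
  (a, b, c, d) \in zero_prod_cover h N.
Proof.
move=> h0 adh bc0 bN cN.
have a0 : a != 0 by apply/negP => /eqP a0; move: adh; rewrite a0 mul0r; lia.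
have ah : (`|a| %| h)%N.
  by rewrite -[h]/(absz h%:Z) -adh abszM dvdn_mulr.
apply/allpairsP; exists ((a, b == 0), if b == 0 then c else b); split.
- apply/allpairsP; exists (a, b == 0); split => //=.
    exact: mem_int_divisors.
  by case: eqP; rewrite !inE.
- by rewrite mem_int_range; case: ifP.
rewrite /= -(dvdz_eq_divz a0 adh); move/eqP: bc0; rewrite mulf_eq0.
by case: eqP => [->|_ /= /eqP ->].
Qed.

(** If d = e a with e = 1 or -1, then b c = e a^2 - h is fixed by a and e. When it is nonzero, b is
    one of its divisors and determines c; when it is zero, a d = h and [zero_prod_cover] applies. *)
Lemma count_tie_ad_le (h N t : nat) (s : seq quad) :
    is_det_seq h N s -> (0 < h)%N -> divisors_bound (N ^ 2 + h) t ->
  (count tie_ad s <= 8 * t * N.*2.+1)%N.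
Proof.
move=> [us ms] h0 tP.
pose l : seq quad :=
  [seq (p.1, b, ((p.1 * (p.2 * p.1) - h%:Z) %/ b)%Z, p.2 * p.1)
  | p <- [seq (a, e) | a <- int_range N, e <- [:: 1; -1]],
    b <- int_divisors (absz (p.1 * (p.2 * p.1) - h%:Z)%R)].
apply: (@leq_trans (size (l ++ zero_prod_cover h N))); last first.
  rewrite size_cat.
  rewrite (_ : (8 * t * _ = N.*2.+1 * 2 * (2 * t) + 4 * t * N.*2.+1)%N).
    apply: leq_add; last first.
      by apply: size_zero_prod_cover => k kh; apply: tP; lia.
    have -> : (N.*2.+1 * 2 =
        size [seq (a, e) | a <- int_range N, e <- [:: 1%R : int; (-1)%R]])%N.
      by rewrite size_allpairs size_int_range.
    apply: size_allpairs_dep_le => -[a e] /allpairsP[[a' e'] /=].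
    rewrite mem_int_range => -[aN ee [-> ->]].
    apply: (size_int_divisors_le tP).
    have : (absz (a' * a')%R <= N ^ 2)%N.
      by rewrite abszM -mulnn; apply: leq_mul; lia.
    by move: ee; rewrite !inE => /orP[/eqP ->|/eqP ->]; lia.
  by lia.
apply: count_le_cover => // -[[[a b] c] d]; rewrite ms.
move=> /and5P[/eqP H aN bN cN dN] /= ad; rewrite mem_cat.
have bch : b * c = a * d - h%:Z by rewrite -H; ring.
have [bc0|bc0] := eqVneq (b * c) 0.
  by rewrite mem_zero_prod_cover ?orbT//; lia.
apply/orP; left.
have [e ee de] : exists2 e, e \in [:: 1; -1] & d = e * a.
  have [->|->] : d = a \/ d = - a by lia.
    by exists 1; rewrite ?inE ?mul1r.
  by exists (-1); rewrite ?inE ?mulN1r.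
apply/allpairsPdep; exists (a, e), b.
rewrite [(a, e).1]/= [(a, e).2]/= -de -bch.
split.
- by apply/allpairsP; exists (a, e); rewrite mem_int_range.
- by apply: mem_int_divisors; rewrite ?absz_gt0// abszM dvdn_mulr.
- congr (_, _, _); apply: dvdz_eq_divz => //.
  by apply: contraNneq bc0 => ->; rewrite mul0r.
Qed.

(** * Parametrization by a congruence *)

Section MaximalCorner.
Variables (h N : nat) (s : seq quad) (t : nat).
Hypotheses (sP : is_det_seq h N s) (h0 : (0 < h)%N) (hN : (h <= 2 * N ^ 2)%N).
Hypothesis tP : divisors_bound (5 * N ^ 2) t.

Let us : uniq s. Proof. by case: sP. Qed.

(* The ranges of i and j are two full periods modulo a; the solution attached
   to (a, i, j) has b = i - a and c = j - a in [-a, a). *)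
Definition congr_pairs (a : nat) : seq (nat * nat) :=
  [seq p <- [seq (i, j) | i <- iota 0 a.*2, j <- iota 0 a.*2]
     | (a %| p.1 * p.2 + h)%N].

Definition congr_triples : seq (nat * (nat * nat)) :=
  [seq (a, p) | a <- iota 1 N, p <- congr_pairs a].

Definition quad_of_triple (x : nat * (nat * nat)) : quad :=
  let: (a, (i, j)) := x in let b := i%:Z - a%:Z in let c := j%:Z - a%:Z in
  (a%:Z, b, c, ((b * c + h%:Z) %/ a%:Z)%Z).

Lemma quad_of_triple_inj : injective quad_of_triple.
Proof.
move=> [a [i j]] [a' [i' j']] /= [aa]; rewrite aa => /addIr[ii] /addIr[jj] _.
by rewrite ii jj.
Qed.

Lemma congr_triples_uniq : uniq congr_triples.
Proof.
apply: allpairs_uniq_dep; first exact: iota_uniq.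
  move=> a _; apply/filter_uniq/allpairs_uniq; rewrite ?iota_uniq//.
  by move=> [? ?] [? ?] _ _ [-> ->].
by move=> [? ?] [? ?] _ _ [-> ->].
Qed.

Lemma mem_congr_triples (a i j : nat) : ((a, (i, j)) \in congr_triples) =
  [&& (0 < a <= N)%N, (i < a.*2)%N, (j < a.*2)%N & (a %| i * j + h)%N].
Proof.
apply/allpairsPdep/and4P => [[a' [[i' j'] []]]|[aN ia ja dv]].
  rewrite mem_iota mem_filter => aN /andP[dv] /allpairsP[[i2 j2]] /=.
  rewrite !mem_iota => -[ia ja [? ?]] [? ? ?]; subst; split => //; lia.
exists a, (i, j); rewrite mem_iota mem_filter dv; split => //.
by apply/allpairsP; exists (i, j); split => //; rewrite mem_iota /=; lia.
Qed.

Lemma dvdz_shift (a i j : nat) :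
  (a%:Z %| (i%:Z - a%:Z) * (j%:Z - a%:Z) + h%:Z)%Z = (a %| i * j + h)%N.
Proof.
have -> : (i%:Z - a%:Z) * (j%:Z - a%:Z) + h%:Z =
    (i * j + h)%:Z + (a%:Z - i%:Z - j%:Z) * a%:Z.
  by rewrite PoszD PoszM; ring.
by rewrite rpredDr ?dvdz_mull ?dvdzz// dvdzE.
Qed.

(** The identity b c + h = a d gives the congruence. The half-open range [-a, a) only misses b = a
    and c = a, which are ties. *)
Lemma count_max_pos_a_le : (count max_pos_a s <=
  size congr_triples + count tie_ab s + count tie_ac s)%N.
Proof.
pose strict (x : quad) := let: (a, b, c, d) := x in
  [&& max_pos_a x, b < a & c < a].
apply: (@leq_trans (count strict s + (count tie_ab s + count tie_ac s))%N).
  apply: leq_trans (leq_trans (count_or_le s _ _)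
    (leq_add (leqnn _) (count_or_le s _ _))).
  apply: sub_count => -[[[a b] c] d] /andP[a0 /and3P[ba ca da]] /=.
  by rewrite a0 ba ca da /=; lia.
rewrite addnA !leq_add2r -(size_map quad_of_triple).
apply: count_le_cover => // -[[[a b] c] d]; case: sP => _ ->.
move=> /and5P[/eqP H aN bN cN dN] /and3P[/andP[a0 /and3P[ba ca da]] bl cl].
have bch : b * c + h%:Z = a * d by rewrite -H; ring.
have aE : `|a|%N = a :> int by lia.
have bE : (absz (b + a)%R)%:Z - `|a|%N%:Z = b by lia.
have cE : (absz (c + a)%R)%:Z - `|a|%N%:Z = c by lia.
apply/mapP; exists (`|a|%N, ((absz (b + a)%R), (absz (c + a)%R))); last first.
  rewrite /= bE cE aE; congr (_, _); apply: dvdz_eq_divz => //; lia.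
rewrite mem_congr_triples; apply/and4P; split; [lia|lia|lia|].
by rewrite -dvdz_shift bE cE aE bch dvdz_mulr.
Qed.

(* Since a |d| <= |b c| + h <= a ^ 2 + h, an overflow a < |d| leaves only h %/ a
   values of |d|, and then b divides the nonzero number a d - h. *)
Definition overflow_cover : seq quad :=
  [seq (p.1, b, ((p.1 * p.2 - h%:Z) %/ b)%Z, p.2)
  | p <- [seq (q.1%:Z, q.2 * e) | q <- [seq (a, (a + j)%N%:Z)
      | a <- iota 1 N, j <- iota 1 (h %/ a)], e <- [:: 1; -1]],
    b <- int_divisors (absz (p.1 * p.2 - h%:Z)%R)].

Lemma size_overflow_cover :
  (size overflow_cover <= 4 * t * \sum_(1 <= a < N.+1) h %/ a)%N.
Proof.
set s1 := [seq (a, (a + j)%N%:Z) | a <- iota 1 N, j <- iota 1 (h %/ a)].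
set s2 := [seq (q.1%:Z, q.2 * e) | q <- s1, e <- [:: 1; -1]].
have -> : (4 * t * \sum_(1 <= a < N.+1) h %/ a = size s2 * (2 * t))%N.
  rewrite size_allpairs size_allpairs_dep sumnE big_map /index_iota subSS subn0.
  by under [in RHS]eq_bigr do rewrite size_iota; rewrite /=; lia.
apply: size_allpairs_dep_le => _ /allpairsP[[q e] /= [+ ee ->]].
move=> /allpairsPdep[a [j [+ + ->]]] /=; rewrite !mem_iota => aN ja.
(* The number factored is at most a (a + j) + h <= N^2 + 2 h <= 5 N^2, which is the source of the
   range in [tP]. *)
apply: (size_int_divisors_le tP).
have : (a * j <= h)%N.
  by rewrite mulnC (leq_trans _ (leq_divM h a))// leq_mul2r; lia.
have : (a * a <= N ^ 2)%N by rewrite -mulnn; apply: leq_mul; lia.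
by move: ee; rewrite !inE => /orP[/eqP ->|/eqP ->]; rewrite PoszD; lia.
Qed.

(** A triple yields |b|, |c| <= a and an exact quotient d. If |d| <= a it is a solution with a
    maximal; otherwise it lies in [zero_prod_cover] when b c = 0 and in [overflow_cover] when
    not. *)
Lemma size_congr_triples_le : (size congr_triples <=
  count max_pos_a s + size overflow_cover + size (zero_prod_cover h N))%N.
Proof.
rewrite -(size_map quad_of_triple) -size_filter -!size_cat uniq_leq_size//.
  by rewrite (map_inj_uniq quad_of_triple_inj) congr_triples_uniq.
move=> x /mapP[[a [i j]]]; rewrite mem_congr_triples.
move=> /and4P[aN ia ja]; rewrite -dvdz_shift => dv ->.
rewrite /quad_of_triple; set b := i%:Z - a%:Z; set c := j%:Z - a%:Z.
rewrite -/b -/c in dv; set d := (_ %/ _)%Z.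
have adE : a%:Z * d = b * c + h%:Z by rewrite mulrC divzK.
have bch : b * c = a%:Z * d - h%:Z by rewrite adE; ring.
have ba : `|b| <= a%:Z by rewrite /b; lia.
have ca : `|c| <= a%:Z by rewrite /c; lia.
rewrite !mem_cat.
have [da|da] := leP `|d| a%:Z.
  rewrite mem_filter; case: sP => _ ->; rewrite /=.
  apply/orP; left; apply/orP; left; apply/andP; split; first by lia.
  by apply/and5P; split; [rewrite adE; lia|lia|lia|lia|lia].
have [bc0|bc0] := eqVneq (b * c) 0.
  by rewrite mem_zero_prod_cover ?orbT//; lia.
apply/orP; left; apply/orP; right.
apply/allpairsPdep; exists (a%:Z, d), b.
rewrite [(a%:Z, d).1]/= [(a%:Z, d).2]/= -bch; split => //.
- apply/allpairsP; exists ((a, `|d|), if 0 <= d then 1 else -1); split.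
  + apply/allpairsPdep; exists a, (`|d| - a)%N; rewrite !mem_iota.
    split; [lia| |congr (_, _); lia].
    suff : (`|d| - a <= h %/ a)%N by lia.
    rewrite leq_divRL; last by lia.
    have : `|a%:Z * d| <= a%:Z * a%:Z + h%:Z.
      rewrite adE (le_trans (ler_normD _ _))// lerD//.
      by rewrite normrM ler_pM.
    rewrite normrM; have -> : `|d| = (`|d| - a)%N%:Z + a%:Z by lia.
    by rewrite mulrDr; lia.
  + by case: ifP.
  + by rewrite /=; congr (_, _); case: ifP; lia.
- by apply: mem_int_divisors; rewrite ?absz_gt0// abszM dvdn_mulr.
- congr (_, _, _); apply: dvdz_eq_divz => //.
  by apply: contraNneq bc0 => ->; rewrite mul0r.
Qed.

(** The factor 8 is four positions of the maximum times two signs. The ties [tie_ab] and [tie_ac]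
    cost 64 = 8 (4 + 4). Conversely 128 = 96 + 32, with 96 = 3 (4 * 4 + 2 * 8) for all ties and 32 =
    8 * 4 for zero products; the last 32 = 8 * 4 comes from overflows. *)
Lemma size_det_seq_triples :
  (size s <= 8 * size congr_triples + 64 * t * N.*2.+1)%N /\
  (8 * size congr_triples <= size s + 128 * t * N.*2.+1
     + 32 * t * \sum_(1 <= a < N.+1) h %/ a)%N.
Proof.
have := size_le_max_counts s; have := max_counts_le_size s.
rewrite (count_max_b sP) (count_max_c sP) (count_max_d sP).
rewrite (count_max_pos_a sP h0).
have := count_tie_ac sP; have := count_tie_cd sP; have := count_tie_bd sP.
have tPh : divisors_bound h t by move=> k kh; apply: tP; lia.
have tPN : divisors_bound (N ^ 2 + h) t by move=> k kh; apply: tP; lia.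
have := count_tie_bc sP; have := count_tie_ab_le sP h0 tPh.
have := count_tie_ad_le sP h0 tPN; have := count_max_pos_a_le.
have := size_congr_triples_le; have := size_overflow_cover.
have := size_zero_prod_cover N tPh.
set u := (t * N.*2.+1)%N.
rewrite -!mulnA -/u; set v := (t * _)%N.
clear.
do 7!move: (count _ _).
lia.
Qed.

End MaximalCorner.

(** * Solutions of the congruence as sums over gcds *)

Section Congruences.
Local Open Scope nat_scope.

Lemma count_modn (m k b : nat) : 0 < m ->
  count (fun i => i == b %[mod m]) (iota 0 (k * m)) = k.
Proof.
move=> m0; elim: k => [|k IH]; first by rewrite mul0n.
rewrite mulSn addnC iotaD count_cat IH add0n -[X in iota X m]addn0 iotaDl.
rewrite count_map -addn1; congr addn.
rewrite (@eq_in_count _ _ (pred1 (b %% m))).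
  by rewrite count_uniq_mem ?iota_uniq// mem_iota /= add0n ltn_pmod.
move=> i; rewrite mem_iota /= add0n => im.
by rewrite modnMDl modn_small.
Qed.

Lemma eqn_mod_mul_coprime (m i j c : nat) :
  coprime m c -> (i * c == j * c %[mod m]) = (i == j %[mod m]).
Proof.
move=> mc; wlog ij : i j / i <= j => [H|].
  have [/H//|/ltnW/H] := leqP i j.
  by rewrite [LHS]eq_sym [RHS]eq_sym.
rewrite [LHS]eq_sym [RHS]eq_sym !eqn_mod_dvd// ?leq_mul2r ?ij ?orbT//.
by rewrite -mulnBl Gauss_dvdl.
Qed.

(** Solvability forces g | h. Dividing by g makes the coefficient of i invertible modulo a / g, so i
    fills one residue class, met 2 g times in [0, 2 a). *)
Lemma count_linear_congruence (a j h : nat) : 0 < a ->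
  count (fun i => a %| i * j + h) (iota 0 a.*2) =
  2 * (gcdn a j * (gcdn a j %| h)).
Proof.
move=> a0; set g := gcdn a j.
have g0 : 0 < g by rewrite gcdn_gt0 a0.
have [gh|gh] := boolP (g %| h); last first.
  rewrite muln0; apply/eqP; rewrite muln0 -leqn0 leqNgt -has_count.
  apply/hasPn => i _; apply: contra gh => aij.
  have : g %| i * j + h by apply: dvdn_trans aij; exact: dvdn_gcdl.
  by rewrite dvdn_addr// dvdn_mull// dvdn_gcdr.
pose a' := a %/ g; pose j' := j %/ g; pose h' := h %/ g.
have aE : a = a' * g by rewrite divnK// dvdn_gcdl.
have jE : j = j' * g by rewrite divnK// dvdn_gcdr.
have hE : h = h' * g by rewrite divnK.
have a'0 : 0 < a' by move: a0; rewrite aE muln_gt0 => /andP[].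
have cp : coprime a' j'.
  by rewrite /coprime -(eqn_pmul2r g0) muln_gcdl -aE -jE mul1n.
(* Bezout gives x j' = -1 modulo a', so the residue class is that of x h'. *)
have [x _ xP] := Bezoutl j' a'0.
rewrite (@eq_count _ _ (fun i => i == x * h' %[mod a'])).
  have -> : a.*2 = 2 * g * a' by move: aE; nia.
  by rewrite count_modn// muln1.
move=> i; rewrite -(eqn_mod_mul_coprime _ _ cp) -(eqn_modDr h').
have /eqP -> : a' %| x * h' * j' + h'.
  have -> : x * h' * j' + h' = h' * (gcdn a' j' + x * j').
    by rewrite (eqP cp); lia.
  by rewrite dvdn_mull.
by rewrite [in LHS]aE jE hE mulnA -mulnDl dvdn_pmul2r.
Qed.

Definition gcd_weight (h g : nat) : nat := g * (g %| h).

(** One factor 2 is the count of i for a fixed j, the other comes from the two periods of j. *)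
Lemma size_congr_pairs (h a : nat) : 0 < a -> size (congr_pairs h a) =
  4 * \sum_(1 <= y < a.+1) gcd_weight h (gcdn a y).
Proof.
move=> a0; rewrite size_filter -sum1_count big_mkcond big_allpairs exchange_big.
rewrite /= (eq_bigr (fun j => 2 * gcd_weight h (gcdn a j))); last first.
  move=> j _; rewrite -count_linear_congruence// -sum1_count [RHS]big_mkcond.
  by apply: eq_bigr => i _; case: ifP.
have -> : iota 0 a.*2 = index_iota 0 a.*2 by rewrite /index_iota subn0.
rewrite -big_distrr/= (@big_cat_nat _ _ _ a)//=; last by lia.
have -> : \sum_(a <= j < a.*2) gcd_weight h (gcdn a j) =
    \sum_(0 <= j < a) gcd_weight h (gcdn a j).
  rewrite -{1}[a]add0n big_addn -addnn addnK.
  by apply: eq_bigr => j _; rewrite gcdnDr.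
(* The period [0, a) becomes [1, a] because gcd(a, 0) = a = gcd(a, a). *)
have -> : \sum_(0 <= j < a) gcd_weight h (gcdn a j) =
    \sum_(1 <= j < a.+1) gcd_weight h (gcdn a j).
  case: a a0 => // a _; rewrite big_nat_recl// [RHS]big_nat_recr//= addnC.
  by rewrite gcdn0 gcdnn big_add1.
lia.
Qed.

(** Reflecting the triangle y <= x covers the square and counts the diagonal twice. This turns the
    sum over a <= N into one over all pairs in [1, N]^2. *)
Lemma double_sum_lower_triangle (f : nat -> nat -> nat) (N : nat) :
    (forall x y, f x y = f y x) ->
  2 * \sum_(1 <= x < N.+1) \sum_(1 <= y < x.+1) f x y =
  \sum_(1 <= x < N.+1) \sum_(1 <= y < N.+1) f x y
  + \sum_(1 <= x < N.+1) f x x.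
Proof.
move=> fC; elim: N => [|N IH]; first by rewrite !big_geq.
rewrite big_nat_recr//= mulnDr IH [X in _ = X + _]big_nat_recr//=.
rewrite [X in _ = _ + X]big_nat_recr//=.
rewrite [X in _ = X + _ + _](eq_bigr
  (fun x => \sum_(1 <= y < N.+1) f x y + f x N.+1)); last first.
  by move=> x _; rewrite big_nat_recr.
rewrite big_split/= ![\sum_(1 <= y < N.+2) _]big_nat_recr//=.
rewrite [\sum_(1 <= y < N.+1) f N.+1 y](eq_bigr (fun y => f y N.+1)) //.
lia.
Qed.

Lemma size_congr_triples (h N : nat) : size (congr_triples h N) =
  2 * (\sum_(1 <= x < N.+1) \sum_(1 <= y < N.+1) gcd_weight h (gcdn x y)
       + \sum_(1 <= x < N.+1) gcd_weight h x).
Proof.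
rewrite size_allpairs_dep sumnE big_map.
rewrite [X in _ + X](eq_bigr (fun x => gcd_weight h (gcdn x x))); last first.
  by move=> x _; rewrite gcdnn.
rewrite -(@double_sum_lower_triangle (fun x y => gcd_weight h (gcdn x y))).
  have -> : iota 1 N = index_iota 1 N.+1 by rewrite /index_iota subSS subn0.
  rewrite mulnA big_distrr /= !big_nat; apply: eq_bigr => a /andP[a0 _].
  exact: size_congr_pairs.
by move=> x y; rewrite gcdnC.
Qed.

End Congruences.

(** * Pairs with a given gcd *)

Section Moebius.
Variable R : realFieldType.

(** The factor at p is -1 if p divides n exactly once and 0 otherwise, which gives the usual Moebius
    function for n > 0. *)
Definition moebius (n : nat) : R :=
  \prod_(p <- primes n) - (logn p n == 1)%:R.

Lemma moebius_norm_le1 (n : nat) : `|moebius n| <= 1.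
Proof.
rewrite /moebius; elim: (primes n) => [|p s IH].
  by rewrite big_nil normr1.
rewrite big_cons normrM mulr_ile1//.
by case: eqP; rewrite ?oppr0 ?normrN ?normr0 ?normr1.
Qed.

Lemma moebius_prime_mul (p d : nat) : prime p -> (0 < d)%N -> ~~ (p %| d)%N ->
  moebius (p * d) = - moebius d.
Proof.
move=> pp d0 pd; have p0 := prime_gt0 pp.
have pe : perm_eq (primes (p * d)) (p :: primes d).
  apply: uniq_perm; first exact: primes_uniq.
    by rewrite /= primes_uniq mem_primes (negbTE pd) !andbF.
  by move=> q; rewrite primesM// primes_prime// !inE.
rewrite /moebius (perm_big _ pe) big_cons lognM//.
rewrite (logn_prime _ pp) eqxx lognE (negbTE pd) !andbF addn0 eqxx /= mulN1r.
congr -%R.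
rewrite !big_seq; apply: eq_bigr => q; rewrite mem_primes => /and3P[qp _ qd].
rewrite lognM// (logn_prime _ pp).
suff /negbTE -> : q != p by rewrite add0n.
by apply: contraNneq pd => <-.
Qed.

Lemma moebius_square_mul (p d : nat) : prime p -> (0 < d)%N -> (p %| d)%N ->
  moebius (p * d) = 0.
Proof.
move=> pp d0 pd; have p0 := prime_gt0 pp.
apply/eqP; rewrite /moebius prodf_seq_eq0; apply/hasP; exists p.
  by rewrite mem_primes pp muln_gt0 p0 d0 dvdn_mulr.
rewrite /= lognM// (logn_prime _ pp) eqxx.
have : (0 < logn p d)%N by rewrite logn_gt0 mem_primes pp d0.
by case: (logn p d) => // k _; rewrite oppr0.
Qed.

(* Multiplication by a prime p of n pairs the divisors of n prime to p with
   those divisible by p exactly once; the others contribute nothing. *)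
Lemma sum_moebius_divisors (n : nat) : (0 < n)%N ->
  \sum_(d <- divisors n) moebius d = (n == 1)%N%:R.
Proof.
move=> n0; have [->|n1] := eqVneq n 1%N.
  by rewrite big_seq1 /moebius big_nil.
have pp : prime (pdiv n) by apply: pdiv_prime; lia.
set p := pdiv n in pp; have pn : (p %| n)%N := pdiv_dvd n.
pose m := (n %/ p)%N; have nE : n = (p * m)%N by rewrite mulnC divnK.
have p0 := prime_gt0 pp.
have m0 : (0 < m)%N by move: n0; rewrite nE muln_gt0 => /andP[].
rewrite (bigID (fun d => p %| d)%N) /= -big_filter.
have pe : perm_eq [seq d <- divisors n | (p %| d)%N]
    [seq (p * d)%N | d <- divisors m].
  apply: uniq_perm; first by rewrite filter_uniq// divisors_uniq.
    rewrite map_inj_uniq ?divisors_uniq// => x y /eqP.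
    by rewrite eqn_pmul2l// => /eqP.
  move=> d; rewrite mem_filter -dvdn_divisors//; apply/andP/mapP => [[pd dn]|].
    exists (d %/ p)%N; last by rewrite mulnC divnK.
    by rewrite -dvdn_divisors// -(dvdn_pmul2l p0) -nE mulnC divnK.
  move=> [e]; rewrite -dvdn_divisors// => em ->; rewrite dvdn_mulr//.
  by rewrite nE dvdn_pmul2l.
rewrite (perm_big _ pe) big_map (bigID (fun d => p %| d)%N) /=.
rewrite big1_seq ?add0r; last first.
  move=> d /andP[pd]; rewrite -dvdn_divisors// => dm.
  by apply: moebius_square_mul => //; exact: dvdn_gt0 dm.
rewrite big_seq_cond (eq_bigr (fun d => - moebius d)); last first.
  move=> d /andP[]; rewrite -dvdn_divisors// => dm pd.
  by apply: moebius_prime_mul => //; exact: dvdn_gt0 dm.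
rewrite -big_seq_cond sumrN.
rewrite -[X in - X]big_filter -[X in _ + X]big_filter.
have pe2 : perm_eq [seq d <- divisors m | ~~ (p %| d)%N]
    [seq d <- divisors n | ~~ (p %| d)%N].
  apply: uniq_perm; rewrite ?filter_uniq ?divisors_uniq// => d.
  rewrite !mem_filter -!dvdn_divisors//; case: (boolP (p %| d)%N) => //= pd.
  by rewrite nE Gauss_dvdr// coprime_sym prime_coprime.
by rewrite (perm_big _ pe2) addNr.
Qed.

(** If g | n, then g m | n means m | n / g, and the sum runs over all divisors of n / g <= N; if
    not, every term vanishes. *)
Lemma sum_moebius_dvd (N g n : nat) : (0 < g)%N -> (0 < n <= N)%N ->
  \sum_(1 <= m < N.+1) moebius m * (g * m %| n)%:R = (n == g)%:R.
Proof.
move=> g0 /andP[n0 nN]; have [gn|gn] := boolP (g %| n)%N; last first.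
  rewrite big1 => [|m _].
    by case: eqVneq gn => // ->; rewrite dvdnn.
  case: (boolP (_ %| _)%N) => [gm|]; last by rewrite mulr0.
  by move: gn; rewrite (dvdn_trans _ gm)// dvdn_mulr.
pose k := (n %/ g)%N; have nE : n = (g * k)%N by rewrite mulnC divnK.
have k0 : (0 < k)%N by move: n0; rewrite nE muln_gt0 => /andP[].
have kN : (k <= N)%N by rewrite (leq_trans _ nN)// nE leq_pmull.
have -> : (n == g) = (k == 1)%N by rewrite nE -[X in _ == X]muln1 eqn_pmul2l.
rewrite -sum_moebius_divisors//.
have pe : perm_eq [seq m <- index_iota 1 N.+1 | (m %| k)%N] (divisors k).
  apply: uniq_perm; rewrite ?filter_uniq ?iota_uniq ?divisors_uniq// => d.
  rewrite mem_filter mem_index_iota -dvdn_divisors//.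
  case: (boolP (d %| k)%N) => //= dk.
  by rewrite (dvdn_gt0 _ dk)//= ltnS (leq_trans _ kN)// dvdn_leq.
rewrite -(perm_big _ pe) big_filter [RHS]big_mkcond; apply: eq_bigr => m _.
by rewrite nE dvdn_pmul2l//; case: ifP; rewrite ?mulr1 ?mulr0.
Qed.

Lemma sum_dvdn (N k : nat) : (0 < k)%N ->
  (\sum_(1 <= x < N.+1) (k %| x) = N %/ k)%N.
Proof.
move=> k0; elim: N => [|N IH]; first by rewrite big_geq// div0n.
by rewrite big_nat_recr//= IH divnS// addnC.
Qed.

Definition gcd_count (N g : nat) : R :=
  \sum_(1 <= x < N.+1) \sum_(1 <= y < N.+1) (gcdn x y == g)%:R.

(** After expanding the indicator of gcd(x, y) = g, the condition g m | gcd(x, y) separates into one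
    on x and one on y, each met N %/ (g m) times. *)
Lemma gcd_count_moebius (N g : nat) : (0 < g)%N ->
  gcd_count N g = \sum_(1 <= m < N.+1) moebius m * (N %/ (g * m))%:R ^+ 2.
Proof.
move=> g0; rewrite /gcd_count.
transitivity (\sum_(1 <= x < N.+1) \sum_(1 <= y < N.+1) \sum_(1 <= m < N.+1)
    moebius m * ((g * m %| x)%:R * (g * m %| y)%:R)).
  rewrite !big_nat; apply: eq_bigr => x /andP[x0 xN].
  rewrite !big_nat; apply: eq_bigr => y /andP[y0 yN].
  rewrite -(@sum_moebius_dvd N)//; last first.
    by rewrite gcdn_gt0 x0 (leq_trans (dvdn_leq x0 (dvdn_gcdl _ _))).
  by apply: eq_bigr => m _; rewrite dvdn_gcd -natrM mulnb.
under eq_bigr do rewrite exchange_big.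
rewrite exchange_big !big_nat; apply: eq_bigr => m /andP[m0 _].
rewrite -sum_dvdn ?muln_gt0 ?g0// natr_sum expr2 mulr_suml mulr_sumr.
apply: eq_bigr => x _; rewrite [RHS]mulrC !mulr_sumr mulr_suml.
apply: eq_bigr => y _; rewrite [RHS]mulrC; congr *%R.
Qed.
End Moebius.

(** * Asymptotics of the gcd counts and of their weighted sum *)

Section GcdCountAsymptotics.
Variable R : realFieldType.

Definition harmonic_sum (N : nat) : R := \sum_(1 <= i < N.+1) i%:R^-1.
Definition zeta2_sum (N : nat) : R := \sum_(1 <= i < N.+1) i%:R ^- 2.
Definition moebius_sum (N : nat) : R :=
  \sum_(1 <= i < N.+1) moebius R i * i%:R ^- 2.

Lemma harmonic_sum_ge1 (N : nat) : (0 < N)%N -> 1 <= harmonic_sum N.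
Proof.
case: N => // N _; rewrite /harmonic_sum big_nat_recl// invr1 lerDl.
by apply: sumr_ge0 => i _; rewrite invr_ge0.
Qed.

Lemma moebius_sum_norm_le (N : nat) : `|moebius_sum N| <= zeta2_sum N.
Proof.
apply: le_trans (ler_norm_sum _ _ _) _; apply: ler_sum => i _.
rewrite normrM [X in _ * X]ger0_norm ?invr_ge0 ?exprn_ge0//.
by rewrite ler_piMl ?invr_ge0 ?exprn_ge0// moebius_norm_le1.
Qed.

(** With x = n / k and q its floor, x^2 - q^2 = (x - q) (x + q) <= 2 x. *)
Lemma floor_sqr_approx (n k : nat) : (0 < k)%N ->
  `|(n %/ k)%:R ^+ 2 - (n%:R / k%:R) ^+ 2| <= 2 * (n%:R / k%:R) :> R.
Proof.
move=> k0; have k0R : 0 < k%:R :> R by rewrite ltr0n.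
have qx : (n %/ k)%:R <= n%:R / k%:R :> R.
  by rewrite ler_pdivlMr// -natrM ler_nat leq_divM.
have xq : n%:R / k%:R < (n %/ k)%:R + 1 :> R.
  by rewrite natr1 ltr_pdivrMr// -natrM ltr_nat ltn_ceil.
have q0 : 0 <= (n %/ k)%:R :> R by [].
move: (n%:R / k%:R) (n %/ k)%:R qx xq q0 => x q qx xq q0.
by rewrite ler_norml; apply/andP; split; nra.
Qed.

Lemma gcd_count_approx (N g : nat) : (0 < g)%N ->
  `|gcd_count R N g - N%:R ^+ 2 / g%:R ^+ 2 * moebius_sum N| <=
  2 * N%:R * harmonic_sum N / g%:R.
Proof.
move=> g0; rewrite gcd_count_moebius// /moebius_sum mulr_sumr -sumrB.
apply: le_trans (ler_norm_sum _ _ _) _.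
rewrite [leRHS]mulrAC /harmonic_sum mulr_sumr big_nat [leRHS]big_nat.
apply: ler_sum => m /andP[m0 _].
have -> : moebius R m * (N %/ (g * m))%:R ^+ 2 -
    N%:R ^+ 2 / g%:R ^+ 2 * (moebius R m * m%:R ^- 2) =
  moebius R m * ((N %/ (g * m))%:R ^+ 2 - (N%:R / (g * m)%:R) ^+ 2).
  by rewrite natrM; field; rewrite !pnatr_eq0 -!lt0n g0 m0.
rewrite normrM; apply: le_trans (ler_pM _ _ (moebius_norm_le1 _ _)
  (floor_sqr_approx _ _)) _ => //; first by rewrite muln_gt0 g0.
by rewrite mul1r natrM invfM !mulrA.
Qed.

Lemma sum_gcd_count (N : nat) :
  \sum_(1 <= g < N.+1) gcd_count R N g = N%:R ^+ 2.
Proof.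
rewrite /gcd_count exchange_big /=; under eq_bigr do rewrite exchange_big /=.
rewrite big_nat (eq_bigr (fun=> N%:R)) => [|x /andP[x0 xN]].
  by rewrite -big_nat sumr_const_nat subSS subn0 -[LHS]mulr_natr expr2.
rewrite big_nat (eq_bigr (fun=> 1)) => [|y /andP[y0 yN]].
  by rewrite -big_nat sumr_const_nat subSS subn0.
rewrite (bigD1_seq (gcdn x y)) ?iota_uniq//=; last first.
  rewrite mem_index_iota gcdn_gt0 x0 ltnS.
  by rewrite (leq_trans (dvdn_leq x0 (dvdn_gcdl _ _))).
by rewrite eqxx big1 ?addr0// => g; rewrite eq_sym => /negbTE ->.
Qed.

(* Summing the approximations over g must return all N^2 pairs. *)
Lemma moebius_zeta2_approx (N : nat) :
  `|N%:R ^+ 2 - N%:R ^+ 2 * (moebius_sum N * zeta2_sum N)| <=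
  2 * N%:R * harmonic_sum N ^+ 2.
Proof.
rewrite -{1}sum_gcd_count.
have -> : N%:R ^+ 2 * (moebius_sum N * zeta2_sum N) =
    \sum_(1 <= g < N.+1) N%:R ^+ 2 / g%:R ^+ 2 * moebius_sum N.
  rewrite /zeta2_sum !mulr_sumr; apply: eq_bigr => g _.
  by rewrite -!mulrA [moebius_sum _ * _]mulrC.
rewrite -sumrB; apply: le_trans (ler_norm_sum _ _ _) _.
rewrite expr2 mulrA {2}/harmonic_sum mulr_sumr big_nat [leRHS]big_nat.
by apply: ler_sum => g /andP[g0 _]; exact: gcd_count_approx.
Qed.

(** Here z plays the role of zeta(2). By [moebius_zeta2_approx] the product of the two partial sums
    is near 1. Replacing [zeta2_sum N] by z costs at most 2 / N, since |[moebius_sum N]| <= z <= 2,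
    and z >= 1 allows the division. *)
Lemma moebius_sum_approx (N : nat) (z : R) : (0 < N)%N -> 1 <= z <= 2 ->
    zeta2_sum N <= z <= zeta2_sum N + N%:R^-1 ->
  `|moebius_sum N - z^-1| <= 4 * harmonic_sum N ^+ 2 / N%:R.
Proof.
move=> N0 /andP[z1 z2] /andP[zN Nz].
have N0R : 0 < N%:R :> R by rewrite ltr0n.
have z0 : 0 < z by lra.
have H1 := harmonic_sum_ge1 N0; have M := moebius_sum_norm_le N.
have E : `|1 - moebius_sum N * zeta2_sum N| <= 2 * harmonic_sum N ^+ 2 / N%:R.
  have := moebius_zeta2_approx N.
  rewrite -{1}[_ ^+ 2]mulr1 -mulrBr normrM ger0_norm ?exprn_ge0//.
  rewrite ler_pdivlMr// => h; rewrite -(ler_pM2r N0R).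
  by move: h; rewrite expr2; nra.
have M2 : `|moebius_sum N * (z - zeta2_sum N)| <= 2 * N%:R^-1.
  by rewrite normrM ler_pM//; [lra|rewrite ger0_norm; lra].
have E2 : `|moebius_sum N * z - 1| <= 4 * harmonic_sum N ^+ 2 / N%:R.
  have -> : moebius_sum N * z - 1 = moebius_sum N * (z - zeta2_sum N)
    - (1 - moebius_sum N * zeta2_sum N) by ring.
  apply: le_trans (ler_normB _ _) _; apply: le_trans (lerD M2 E) _.
  have i0 : 0 < N%:R^-1 :> R by rewrite invr_gt0.
  have H2 : 1 <= harmonic_sum N ^+ 2 by rewrite exprn_ege1.
  by move: (N%:R^-1) (_ ^+ 2) i0 H2 => u v i0 H2; nra.
have -> : moebius_sum N - z^-1 = (moebius_sum N * z - 1) / z.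
  by field; rewrite gt_eqF.
rewrite normrM normfV (gtr0_norm z0) ler_pdivrMr//.
apply: le_trans E2 _; rewrite ler_peMr// !mulr_ge0 ?exprn_ge0 ?invr_ge0//; lra.
Qed.

(** In 6 = 2 + 4, the 2 is the rounding error of [gcd_count_approx] and the 4 comes from replacing
    [moebius_sum N] by 1 / z; H >= 1 and g >= 1 bring both to the same shape. *)
Lemma gcd_count_zeta2_approx (N g : nat) (z : R) :
    (0 < N)%N -> (0 < g)%N -> 1 <= z <= 2 ->
    zeta2_sum N <= z <= zeta2_sum N + N%:R^-1 ->
  `|gcd_count R N g - N%:R ^+ 2 / z / g%:R ^+ 2| <=
  6 * N%:R * harmonic_sum N ^+ 2 / g%:R.
Proof.
move=> N0 g0 z12 zN.
have := gcd_count_approx N g0; have := moebius_sum_approx N0 z12 zN.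
have H1 := harmonic_sum_ge1 N0.
have N0R : 0 < N%:R :> R by rewrite ltr0n.
have g1 : 1 <= g%:R :> R by rewrite ler1n.
move: (gcd_count _ _ _) (moebius_sum N) (harmonic_sum N) H1 => G M H H1 MH GM.
have -> : G - N%:R ^+ 2 / z / g%:R ^+ 2 =
    (G - N%:R ^+ 2 / g%:R ^+ 2 * M) + N%:R ^+ 2 / g%:R ^+ 2 * (M - z^-1).
  by field; rewrite !gt_eqF//; lra.
apply: le_trans (ler_normD _ _) _.
have -> : 6 * N%:R * H ^+ 2 / g%:R =
    2 * N%:R * H ^+ 2 / g%:R + 4 * N%:R * H ^+ 2 / g%:R by field; lra.
apply: lerD.
  apply: le_trans GM _; rewrite ler_pM2r ?invr_gt0; last by lra.
  by rewrite ler_pM2l ?mulr_gt0// expr2 ler_peMr//; lra.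
rewrite normrM ger0_norm; last by rewrite divr_ge0// exprn_ge0.
apply: le_trans (ler_wpM2l _ MH) _; first by rewrite divr_ge0// exprn_ge0.
have -> : N%:R ^+ 2 / g%:R ^+ 2 * (4 * H ^+ 2 / N%:R) =
  4 * N%:R * H ^+ 2 / g%:R / g%:R by field; rewrite !gt_eqF//; lra.
rewrite ler_pdivrMr; last by lra.
by rewrite ler_peMr// !mulr_ge0 ?exprn_ge0 ?invr_ge0//; lra.
Qed.

Lemma sum_gcd_weight (h N : nat) : (0 < h)%N ->
  (\sum_(1 <= x < N.+1) \sum_(1 <= y < N.+1) gcd_weight h (gcdn x y))%:R =
  \sum_(g <- divisors h) g%:R * gcd_count R N g.
Proof.
move=> h0; rewrite natr_sum /gcd_count.
under [RHS]eq_bigr do rewrite mulr_sumr.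
rewrite exchange_big; apply: eq_bigr => x _; rewrite natr_sum.
under [RHS]eq_bigr do rewrite mulr_sumr.
rewrite exchange_big; apply: eq_bigr => y _.
rewrite /gcd_weight dvdn_divisors// natrM.
have [gh|gh] := boolP (_ \in _).
  rewrite (bigD1_seq _ gh) ?divisors_uniq//= eqxx big1 ?addr0// => g.
  by rewrite eq_sym => /negbTE ->; rewrite mulr0.
rewrite mulr0 big1_seq// => g /= gh'.
by case: eqP gh => [->|_ _]; rewrite ?gh' ?mulr0.
Qed.

Lemma sum_gcd_weight_diag (h N : nat) : (0 < h)%N ->
  (\sum_(1 <= x < N.+1) gcd_weight h x <= size (divisors h) * N)%N.
Proof.
move=> h0; apply: (@leq_trans (\sum_(1 <= x < N.+1 | x %| h) N)%N).
  rewrite [leqRHS]big_mkcond !big_nat; apply: leq_sum => x /andP[_ xN].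
  by rewrite /gcd_weight; case: ifP; rewrite ?muln0 ?muln1.
rewrite big_const_seq iter_addn_0 mulnC leq_mul2r -size_filter.
apply/orP; right; apply: uniq_leq_size.
  by rewrite filter_uniq// iota_uniq.
by move=> x; rewrite mem_filter dvdn_divisors// => /andP[].
Qed.

(** Each divisor g of h contributes g N^2 / (z g^2) = N^2 / (z g), with error g (6 N H^2 / g) = 6 N
    H^2. With at most t divisors and a diagonal of at most t N, the constant is 112 = 16 * 6 +
    16. *)
Lemma size_congr_triples_approx (h N t : nat) (z : R) :
    (0 < h)%N -> (0 < N)%N -> (size (divisors h) <= t)%N -> 1 <= z <= 2 ->
    zeta2_sum N <= z <= zeta2_sum N + N%:R^-1 ->
  `|8 * (size (congr_triples h N))%:R
    - 16 / z * N%:R ^+ 2 * \sum_(d <- divisors h) d%:R^-1| <=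
  112 * t%:R * harmonic_sum N ^+ 2 * N%:R.
Proof.
move=> h0 N0 ht z12 zN; have z0 : 0 < z by case/andP: z12 => z1 _; lra.
have H1 : 1 <= harmonic_sum N ^+ 2 by rewrite exprn_ege1// harmonic_sum_ge1.
have N0R : 0 < N%:R :> R by rewrite ltr0n.
rewrite size_congr_triples natrM natrD sum_gcd_weight//.
have := sum_gcd_weight_diag N h0; set B := (\sum_(1 <= _ < _) _)%N => Bt.
have {}Bt : B%:R <= t%:R * N%:R :> R.
  by rewrite -natrM ler_nat (leq_trans Bt)// leq_mul2r ht orbT.
set A := \sum_(g <- _) _; set D := \sum_(d <- _) _.
have AD : `|A - N%:R ^+ 2 / z * D| <= t%:R * (6 * N%:R * harmonic_sum N ^+ 2).
  rewrite /A /D mulr_sumr -sumrB; apply: le_trans (ler_norm_sum _ _ _) _.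
  apply: (@le_trans _ _
    (\sum_(g <- divisors h) 6 * N%:R * harmonic_sum N ^+ 2)).
    rewrite big_seq [leRHS]big_seq; apply: ler_sum => g.
    rewrite -dvdn_divisors// => /(dvdn_gt0 h0) g0.
    have g0R : 0 < g%:R :> R by rewrite ltr0n.
    have -> : g%:R * gcd_count R N g - N%:R ^+ 2 / z / g%:R =
        g%:R * (gcd_count R N g - N%:R ^+ 2 / z / g%:R ^+ 2).
      by field; rewrite !gt_eqF//; lra.
    rewrite normrM gtr0_norm// mulrC -ler_pdivlMr//.
    exact: gcd_count_zeta2_approx.
  rewrite big_const_seq count_predT iter_addr_0 -[leLHS]mulr_natl ler_wpM2r//.
    by rewrite mulr_ge0 ?(le_trans _ H1)// mulr_ge0.
  by rewrite ler_nat.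
have -> : 8 * (2%:R * (A + B%:R)) - 16 / z * N%:R ^+ 2 * D =
  16 * (A - N%:R ^+ 2 / z * D) + 16 * B%:R by ring.
apply: le_trans (ler_normD _ _) _; rewrite !normrM !normr_nat.
have tN : t%:R * N%:R <= t%:R * N%:R * harmonic_sum N ^+ 2.
  by rewrite ler_peMr// mulr_ge0.
have B0 : 0 <= B%:R :> R by [].
move: AD Bt tN; move: (`|_|) (harmonic_sum N ^+ 2) => u v; lra.
Qed.

Lemma sum_floor_le (h N : nat) :
  (\sum_(1 <= a < N.+1) h %/ a)%:R <= h%:R * harmonic_sum N :> R.
Proof.
rewrite natr_sum /harmonic_sum mulr_sumr big_nat [leRHS]big_nat.
apply: ler_sum => a /andP[a0 _].
by rewrite ler_pdivlMr ?ltr0n// -natrM ler_nat leq_divM.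
Qed.

Lemma size_det_seq_approx (h N t : nat) (s : seq quad) (z : R) :
    is_det_seq h N s -> (0 < h)%N -> (0 < N)%N -> (h <= 2 * N ^ 2)%N ->
    divisors_bound (5 * N ^ 2) t -> 1 <= z <= 2 ->
    zeta2_sum N <= z <= zeta2_sum N + N%:R^-1 ->
  `|(size s)%:R - 16 / z * N%:R ^+ 2 * \sum_(d <- divisors h) d%:R^-1| <=
  528 * (t%:R * harmonic_sum N ^+ 2) * (h%:R + N%:R).
Proof.
move=> sP h0 N0 hN tP z12 zN.
have th : (size (divisors h) <= t)%N by apply: tP; lia.
have := size_congr_triples_approx h0 N0 th z12 zN.
have [] := size_det_seq_triples sP h0 hN tP.
have H1 := harmonic_sum_ge1 N0; have F := sum_floor_le h N.
set X := 16 / z * _ * _; set n := size (congr_triples _ _); set m := size s.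
set f := (\sum_(1 <= a < N.+1) h %/ a)%N in F *.
(* Since N >= 1, 2 N + 1 <= 3 N; this turns 64 and 128 into 192 and 384. The final 528 is 384 + 32 +
   112. *)
have tN3 : (t * N.*2.+1 <= 3 * (t * N))%N by rewrite mulnCA leq_mul2l; lia.
rewrite -!mulnA => le1 le2 le3.
have {}le1 : m%:R <= 8 * n%:R + 192 * (t%:R * N%:R) :> R.
  have : (m <= 8 * n + 192 * (t * N))%N by lia.
  by rewrite -(ler_nat R) natrD !natrM.
have {}le2 : 8 * n%:R <= m%:R + 384 * (t%:R * N%:R) + 32 * (t%:R * f%:R) :> R.
  have : (8 * n <= m + 384 * (t * N) + 32 * (t * f))%N by lia.
  by rewrite -(ler_nat R) 2!natrD !natrM.
have tf : t%:R * f%:R <= t%:R * h%:R * harmonic_sum N ^+ 2.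
  rewrite -mulrA ler_wpM2l// (le_trans F)// ler_wpM2l// expr2 ler_peMr//; lra.
have tN : t%:R * N%:R <= t%:R * N%:R * harmonic_sum N ^+ 2.
  by rewrite ler_peMr ?mulr_ge0// exprn_ege1.
have -> : m%:R - X = (m%:R - 8 * n%:R) + (8 * n%:R - X) by ring.
apply: le_trans (ler_normD _ _) _.
have d1 : `|m%:R - 8 * n%:R| <= 384 * (t%:R * N%:R) + 32 * (t%:R * f%:R) :> R.
  have : 0 <= t%:R * N%:R :> R by rewrite mulr_ge0.
  have : 0 <= t%:R * f%:R :> R by rewrite mulr_ge0.
  by rewrite ler_norml; move=> *; apply/andP; split; lra.
have th0 : 0 <= t%:R * h%:R * harmonic_sum N ^+ 2.
  by rewrite mulr_ge0 ?sqr_ge0// mulr_ge0.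
have tN0 : 0 <= t%:R * N%:R * harmonic_sum N ^+ 2.
  by rewrite mulr_ge0 ?sqr_ge0// mulr_ge0.
apply: le_trans (lerD d1 le3) _.
move: tf tN th0 tN0; move: (harmonic_sum N ^+ 2) => v; lra.
Qed.

End GcdCountAsymptotics.

(** * Zeta, harmonic and divisor estimates *)

Lemma series_riemannR2 (R : realType) (N : nat) :
  series (riemannR (2 : R)) N = zeta2_sum R N.
Proof.
rewrite /series /zeta2_sum big_add1 /=; apply: eq_bigr => i _.
by rewrite /riemannR powR_mulrn.
Qed.

(** Telescoping with 1 / (x + 1)^2 <= 1 / x - 1 / (x + 1); the subtracted last term carries the
    induction. *)
Lemma zeta2_sum_le (R : realType) (N k : nat) : (0 < N)%N ->
  zeta2_sum R (N + k) <= zeta2_sum R N + N%:R^-1 - (N + k)%:R^-1.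
Proof.
move=> N0; elim: k => [|k IH]; first by rewrite addn0 addrK.
rewrite addnS [leLHS]big_nat_recr//= -/(zeta2_sum R (N + k)).
apply: (le_trans (lerD IH (lexx _))).
have x0 : (0 : R) < (N + k)%:R by rewrite ltr0n addn_gt0 N0.
rewrite -natr1; move: (zeta2_sum R N + _) (N + k)%:R x0 => u x x0.
rewrite -subr_ge0 (_ : _ - _ = (x * (x + 1) ^+ 2)^-1).
  by rewrite invr_ge0 mulr_ge0 ?sqr_ge0// ltW.
by field; rewrite !gt_eqF//; lra.
Qed.

Lemma zeta2_bounds (R : realType) (N : nat) : (0 < N)%N ->
  zeta2_sum R N <= zeta (2 : R) <= zeta2_sum R N + N%:R^-1.
Proof.
move=> N0; have cv := @is_cvg_zeta2 R; apply/andP; split.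
  rewrite -series_riemannR2; apply: nondecreasing_cvgn_le => //.
  by apply: nondecreasing_series => n _ _; apply/ltW/riemannR_gt0.
apply: limr_le => //; exists N => // n /= Nn.
rewrite series_riemannR2 -(subnKC Nn); apply: le_trans (zeta2_sum_le _ _ N0) _.
by rewrite gerBl invr_ge0.
Qed.

Lemma zeta2_ge1_le2 (R : realType) : 1 <= zeta (2 : R) <= 2.
Proof.
by have := @zeta2_bounds R 1 isT; rewrite /zeta2_sum big_nat1 expr1n invr1.
Qed.

(** The inductive step is ln (1 + x) <= x at x = -1 / (N + 2), where 1 + x = (N + 1) / (N + 2). *)
Lemma harmonic_sum_le_ln (R : realType) (N : nat) :
  harmonic_sum R N.+1 <= 1 + ln N.+1%:R.
Proof.
elim: N => [|N IH]; first by rewrite /harmonic_sum big_nat1 ln1 addr0 invr1.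
rewrite [leLHS]big_nat_recr//= -/(harmonic_sum R N.+1).
apply: (le_trans (lerD IH (lexx _))); rewrite -addrA lerD2l -lerBrDl.
have n1 : (0 : R) < N.+1%:R by rewrite ltr0n.
have n2 : (0 : R) < N.+2%:R by rewrite ltr0n.
rewrite -ln_div ?posrE// -[leRHS]opprK -lnV ?posrE ?divr_gt0// invfM invrK.
rewrite lerNr (_ : _ * _ = 1 + - N.+2%:R^-1).
  by rewrite le_ln1Dx// ltrN2 invf_lt1// ltr1n.
by rewrite -[N.+2%:R]natr1; field; lra.
Qed.

(** Use 1 <= N^e and ln N = ln (N^e) / e <= N^e / e. *)
Lemma harmonic_sum_le_powR (R : realType) (e : R) (N : nat) :
  0 < e -> (0 < N)%N -> harmonic_sum R N <= (1 + e^-1) * N%:R `^ e.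
Proof.
move=> e0; case: N => // N _; apply: le_trans (harmonic_sum_le_ln R N) _.
have p0 : 0 < N.+1%:R `^ e by rewrite powR_gt0.
have p1 : 1 <= N.+1%:R `^ e.
  by rewrite -[leLHS](powRr0 N.+1%:R) ler_powR ?ler1n// ltW.
rewrite mulrDl mul1r lerD// -[leLHS](mulKf (lt0r_neq0 e0)) ler_pM2l ?invr_gt0//.
by rewrite -ln_powR ltW// ln_sublinear.
Qed.

(** Every divisor is d' p^i with d' | m and i <= e. *)
Lemma size_divisors_mul_prime_pow (p m e : nat) : prime p -> (0 < m)%N ->
  coprime p m -> (size (divisors (m * p ^ e)) <= e.+1 * size (divisors m))%N.
Proof.
move=> pp m0 pm; have p0 := prime_gt0 pp.
have n0 : (0 < m * p ^ e)%N by rewrite muln_gt0 m0 expn_gt0 p0.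
rewrite -[e.+1](size_iota 0).
rewrite -(size_allpairs (fun i d => d * p ^ i)%N (iota 0 e.+1) (divisors m)).
apply: uniq_leq_size; first exact: divisors_uniq.
move=> d; rewrite -dvdn_divisors// => dn; have d0 := dvdn_gt0 n0 dn.
have [d' pd' dE] := pfactor_coprime pp d0.
apply/allpairsP; exists (logn p d, d'); split=> //.
  rewrite mem_iota leq0n add0n ltnS [_.1]/=.
  have := dvdn_leq_log p n0 dn.
  by rewrite lognM ?expn_gt0 ?p0// pfactorK// (logn_coprime pm) add0n.
rewrite [_.2]/= -dvdn_divisors// -(@Gauss_dvdl _ _ (p ^ e)).
  by apply: dvdn_trans dn; rewrite dE dvdn_mulr.
by rewrite coprime_sym coprimeXl.
Qed.

(** * The divisor bound: at most O(n^e) divisors *)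

Section DivisorBound.
Variables (R : realType) (e : R).
Hypothesis e0 : 0 < e.

Lemma powR_prime_pow_ge (q k : nat) : (1 < q)%N ->
  (2 `^ e) ^+ k <= (q ^ k)%N%:R `^ e.
Proof.
move=> q1; rewrite natrX -[_ ^+ k in leRHS]powR_mulrn// -powRrM mulrC powRrM.
rewrite powR_mulrn ?powR_ge0//.
by rewrite lerXn2r ?nnegrE ?powR_ge0// ge0_ler_powR ?nnegrE ?ler_nat// ltW.
Qed.

(** With r = 2^e, (1 + 1 / (r - 1)) (1 + (r - 1) k) >= k + 1, so this constant suits a lower bound 1
    + (r - 1) k for r^k. *)
Definition divisor_const : R := 1 + (2 `^ e - 1)^-1.

Lemma powR2_gt1 : 1 < 2 `^ e.
Proof.
by have := gt0_ltr_powR e0 (_ : 1 \in Num.nneg) (_ : 2 \in Num.nneg);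
  rewrite powR1; apply; rewrite ?nnegrE// ltr1n.
Qed.

Lemma divisor_const_ge1 : 1 <= divisor_const.
Proof. by rewrite lerDl invr_ge0 subr_ge0 ltW// powR2_gt1. Qed.

(* Bernoulli's inequality for the base 2 `^ e *)
Lemma succ_le_divisor_const (k : nat) :
  k.+1%:R <= divisor_const * (2 `^ e) ^+ k.
Proof.
have r1 := powR2_gt1; rewrite /divisor_const.
move: (2 `^ e) r1 => r r1.
have bern : 1 + (r - 1) * k%:R <= r ^+ k.
  elim: k => [|k IH]; first by rewrite mulr0 addr0.
  rewrite exprS -[k.+1%:R]natr1.
  have : r * (1 + (r - 1) * k%:R) <= r * r ^+ k by rewrite ler_pM2l//; lra.
  have : 0 <= (r - 1) ^+ 2 * k%:R by rewrite mulr_ge0// sqr_ge0.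
  by move: (r ^+ k) (k%:R) => u v; lra.
have d1 : 0 < r - 1 by lra.
have c0 : 0 <= 1 + (r - 1)^-1 by rewrite addr_ge0// invr_ge0 ltW.
apply: le_trans (ler_wpM2l c0 bern).
have i0 : 0 < (r - 1)^-1 by rewrite invr_gt0.
rewrite -natr1 mulrDl mul1r mulrDr mulr1 mulrA mulVf ?gt_eqF// mul1r.
have : 0 <= (r - 1) * k%:R by rewrite mulr_ge0// ltW.
by move: ((r - 1) * k%:R) (k%:R) => u v; lra.
Qed.

(** An integer above 2^(1/e), so that p^e >= 2 from there on. *)
Definition large_prime : nat := (Num.truncn (2 `^ e^-1)).+1.

Lemma two_le_powR (p : nat) : (large_prime <= p)%N -> 2 <= p%:R `^ e.
Proof.
move=> Pp; have : 2 `^ e^-1 <= p%:R.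
  have /andP[_ /ltW h] := truncn_itv (powR_ge0 (2 : R) e^-1).
  by rewrite (le_trans h)// ler_nat.
move=> /(ge0_ler_powR (ltW e0)) h.
have {h} := h _ _; rewrite !nnegrE powR_ge0 ler0n => /(_ isT isT).
by rewrite -powRrM mulVf ?gt_eqF// powRr1.
Qed.

(* Primes above large_prime cost nothing, since k + 1 <= 2 ^ k <= (p ^ k) ^ e;
   each smaller prime costs one factor divisor_const. *)
Lemma size_divisors_le_count (n : nat) : (0 < n)%N ->
  (size (divisors n))%:R <=
  divisor_const ^+ count (fun p => p < large_prime)%N (primes n) * n%:R `^ e.
Proof.
have [b] := ubnP n; elim: b n => // b IH n nb n0.
have [->|n1] := eqVneq n 1%N; first by rewrite powR1 mulr1.
have pp : prime (pdiv n) by apply: pdiv_prime; lia.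
set p := pdiv n in pp; have pn : (p %| n)%N := pdiv_dvd n.
have p0 := prime_gt0 pp; have p1 := prime_gt1 pp.
(* The induction removes the full power of the smallest prime divisor, which leaves a smaller m
   prime to p. *)
have [m pm nE] := pfactor_coprime pp n0.
set k := logn p n in nE.
have k0 : (0 < k)%N by rewrite logn_gt0 mem_primes pp n0.
have m0 : (0 < m)%N by move: n0; rewrite nE muln_gt0 => /andP[].
have mn : (m < n)%N.
  by rewrite nE -[ltnLHS]muln1 ltn_pmul2l// -(exp1n k) ltn_exp2r.
have pe : perm_eq (primes n) (p :: primes m).
  apply: uniq_perm; first exact: primes_uniq.
    rewrite /= primes_uniq mem_primes pp m0 /= andbT.
    by rewrite -prime_coprime.
  move=> q; rewrite nE primesM ?expn_gt0 ?p0// primesX// (primes_prime pp) !inE.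
  by rewrite orbC.
rewrite (permP pe) /=.
have := size_divisors_mul_prime_pow k pp m0 pm; rewrite -nE -(ler_nat R) natrM.
move=> /le_trans; apply.
have {IH} := IH m (leq_trans mn nb) m0.
set c := count _ _; set d := size _ => IH.
have c1 := divisor_const_ge1.
have -> : n%:R `^ e = m%:R `^ e * (p ^ k)%N%:R `^ e.
  by rewrite {1}nE natrM powRM.
rewrite [m%:R `^ e * _]mulrC exprD mulrACA; apply: ler_pM => //.
have [pP|pP] := ltnP p large_prime; rewrite /= ?expr1 ?expr0 ?mul1r.
  apply: le_trans (succ_le_divisor_const k) _.
  by apply: ler_wpM2l; [exact: le_trans ler01 c1|exact: powR_prime_pow_ge].
apply: (@le_trans _ _ (2 ^+ k)); first by rewrite -natrX ler_nat ltn_expl.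
rewrite natrX -[_ ^+ k in leRHS]powR_mulrn// -powRrM mulrC powRrM.
by rewrite powR_mulrn ?powR_ge0// lerXn2r ?nnegrE ?powR_ge0// two_le_powR.
Qed.

(** There are at most [large_prime] primes below [large_prime], which makes the constant independent
    of n. *)
Lemma size_divisors_le_powR : exists2 K : R, 1 <= K &
  forall n : nat, (0 < n)%N -> (size (divisors n))%:R <= K * n%:R `^ e.
Proof.
exists (divisor_const ^+ large_prime).
  by rewrite exprn_ege1// divisor_const_ge1.
move=> n n0; apply: le_trans (size_divisors_le_count n0) _.
rewrite ler_wpM2r ?powR_ge0// ler_weXn2l ?divisor_const_ge1//.
rewrite -[leqRHS](size_iota 0); apply: count_le_cover; first exact: primes_uniq.
by move=> p _ pP; rewrite mem_iota.
Qed.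

End DivisorBound.

(** * Application to T(h, N) and choice of constants *)

Lemma is_det_seq_det_box (h N : nat) :
  is_det_seq h N (fset_set (det_box h N)).
Proof.
split=> [|a b c d]; first exact: fset_uniq.
have -> : ((a, b, c, d) \in (fset_set (det_box h N) : seq quad)) =
    ((a, b, c, d) \in fset_set (det_box h N)) by [].
rewrite in_fset_set; last exact: finite_det_box.
apply/idP/and5P => [|[/eqP ? ? ? ? ?]]; rewrite inE /= => //.
by case=> -> *.
Qed.

Theorem theorem1p1 (R : realType) (eps : R) (heps : 0 < eps) :
  exists C : R, 0 < C /\
    forall N h : nat, (0 < N)%N -> (1 <= h)%N -> (h <= 2 * N ^ 2)%N ->
      `| (T h N)%:R
         - 16 / zeta (2 : R) * N%:R ^+ 2 * (\sum_(d <- divisors h) d%:R^-1) |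
      <= C * (N%:R `^ eps * (h%:R + N%:R)).
Proof.
(* Four powers N^e are spent: two in the divisor bound at 5 N^2, two in the squared harmonic sum. *)
have [e e0 ->] : exists2 e : R, 0 < e & eps = e * 4%:R.
  by exists (eps / 4%:R); [rewrite divr_gt0|rewrite divfK// pnatr_eq0].
have [K K1 KP] := size_divisors_le_powR e0.
have K0 : 0 < K by rewrite (lt_le_trans _ K1).
pose L := 1 + e^-1; have L0 : 0 < L by rewrite addr_gt0// invr_gt0.
have c0 : 0 < 528 :> R by rewrite ltr0n.
(* K is the divisor constant, 5^e comes from the range 5 N^2, and L bounds the harmonic sum by L
   N^e. *)
exists (528 * (K * 5 `^ e * L ^+ 2)); split.
  apply/(mulr_gt0 c0)/mulr_gt0; last exact: exprn_gt0.
  by apply/(mulr_gt0 K0)/powR_gt0; rewrite ltr0n.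
move=> N h N0 h0 hN; pose B := K * (5 * N ^ 2)%N%:R `^ e.
have B0 : 0 <= B by rewrite mulr_ge0 ?powR_ge0// ltW.
have n1 : (1 : R) <= N%:R by rewrite ler1n.
have tP : divisors_bound (5 * N ^ 2) (Num.truncn B).
  move=> k kN; rewrite truncn_ge_nat//.
  (* [divisors 0] and [divisors 1] compute to the same list, so the bound at 1 settles k = 0. *)
  have [->|k0] := posnP k.
    apply: (le_trans (KP 1%N isT)); rewrite ler_wpM2l ?(ltW K0)//.
    by rewrite ge0_ler_powR ?nnegrE ?(ltW e0)// ler_nat; lia.
  apply: (le_trans (KP _ k0)); rewrite ler_wpM2l ?(ltW K0)//.
  by rewrite ge0_ler_powR ?nnegrE ?(ltW e0)// ler_nat.
apply: le_trans (size_det_seq_approx (is_det_seq_det_box h N) h0 N0 hN tP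
  (zeta2_ge1_le2 R) (zeta2_bounds R N0)) _.
move: (528 : R) c0 => c /ltW c0.
rewrite [leRHS]mulrA ler_wpM2r ?addr_ge0// -[leRHS]mulrA ler_wpM2l//.
have tB : (Num.truncn B)%:R <= B by rewrite truncn_le.
have H1 := harmonic_sum_ge1 R N0.
have HL : harmonic_sum R N ^+ 2 <= (L * N%:R `^ e) ^+ 2.
  rewrite lerXn2r ?nnegrE ?(le_trans _ H1) ?mulr_ge0 ?powR_ge0 ?(ltW L0)//.
  exact: harmonic_sum_le_powR.
apply: le_trans (ler_pM _ (sqr_ge0 _) tB HL) _ => //.
rewrite powRrM powR_mulrn ?powR_ge0//.
have -> : B = K * 5 `^ e * (N%:R `^ e) ^+ 2.
  rewrite /B natrM powRM// natrX -[N%:R ^+ 2]powR_mulrn// -powRrM.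
  by rewrite [2%:R * e]mulrC powRrM powR_mulrn ?powR_ge0// mulrA.
rewrite le_eqVlt; apply/orP; left; apply/eqP; ring.
Qed.
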